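(* Let $f=\sum_{i=1}^\infty\frac{1}{(i+1)!}z_i\in H^2$, where $H^2$ is the Drury-Arveson space in infinitely many variables, and let $\mathcal{M}_f$ be the (homogeneous) submodule of $H^2$ generated by $f$. Then $\mathcal{M}_f$ contains no nonzero polynomials.
   Context: $\mathbb{B}$ is the open unit ball of $\ell^2$. $H^2$ is the reproducing kernel Hilbert space of holomorphic functions on $\mathbb{B}$ with kernel $\mathcal{K}_\lambda(z)=\frac1{1-\langle z,\lambda\rangle}$, $\lambda\in\mathbb{B}$. A submodule of $H^2$ is a closed subspace invariant under multiplication by every coordinate function $z_i$, $i\ge1$; the submodule generated by $f$ is the smallest submodule containing $f$. Polynomials are elements of $\mathcal{P}_\infty=\bigcup_{m\ge1}\mathbb{C}[z_1,\dots,z_m]$. One has the orthogonal decomposition $\mathcal{M}_f=\bigoplus_{n\ge1}\mathcal{M}_n$ with $\mathcal{M}_n=\overline{\operatorname{span}}\{z^\alpha f:|\alpha|=n-1\}$, $\alpha$ running over finitely supported multi-indices. *)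

(* Defs.v *)
(* R is an arbitrary model [realType] of the real numbers and
   R[i] its field of complex numbers.  Only the canonical structures of [mpoly]
   are imported: its notations clash with those of MathComp-Analysis. *)
From mathcomp Require Import all_boot all_order all_algebra.
From mathcomp Require Import all_classical all_reals all_analysis.
From mathcomp Require Import complex.
From mathcomp Require mpoly.
Import (canonicals) mpoly.

Set Implicit Arguments.
Unset Strict Implicit.
Unset Printing Implicit Defensive.

Import Order.TTheory GRing.Theory Num.Theory.
Import numFieldNormedType.Exports.

Local Open Scope classical_set_scope.
Local Open Scope ring_scope.
Local Open Scope complex_scope.

(* Coordinates are numbered from 0: the variable z_(i+1) of the usual
   numbering is the coordinate [z i]. *)

(* The squared norm of l^2, equal to +oo off l^2. *)
Definition l2_sqnorm (R : realType) (z : nat -> R[i]) : \bar R :=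
  (\sum_(0 <= k <oo) ((Normc.normc (z k)) ^+ 2)%:E)%E.

Definition in_l2 (R : realType) (z : nat -> R[i]) : Prop :=
  (l2_sqnorm z < +oo)%E.

Definition l2_norm (R : realType) (z : nat -> R[i]) : R :=
  Num.sqrt (fine (l2_sqnorm z)).

Definition l2_ball (R : realType) : Type :=
  {z : nat -> R[i] | (l2_sqnorm z < 1)%E}.

(* Sum of a complex series; [^o] gives R[i] its topology as a normed space
   over itself. *)
Definition csum (R : realType) (u : nat -> R[i]) : R[i] :=
  limn (series (u : nat -> R[i]^o)).

Definition l2_inner (R : realType) (z w : nat -> R[i]) : R[i] :=
  csum (fun k => z k * ((w k)^*)%C).

(* Frechet differentiability over the complex numbers at every point of the
   ball; L is the differential, a bounded linear functional on l^2. *)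
Definition holomorphic (R : realType) (g : l2_ball R -> R[i]) : Prop :=
  forall z : l2_ball R, exists L : (nat -> R[i]) -> R[i],
    [/\ forall (a : R[i]) u v, in_l2 u -> in_l2 v ->
          L ((a \*o u) \+ v) = a * L u + L v,
        exists M : R, forall u, in_l2 u -> Normc.normc (L u) <= M * l2_norm u
      & forall e : R, 0 < e -> exists2 d : R, 0 < d &
          forall w : l2_ball R, l2_norm (sval w \- sval z) < d ->
            Normc.normc (g w - g z - L (sval w \- sval z))
              <= e * l2_norm (sval w \- sval z)].

Section HilbertFunctionSpace.
Variables (R : realType) (X : Type).
Implicit Types (H S : set (X -> R[i])) (f g h : X -> R[i]).
Implicit Types ip : (X -> R[i]) -> (X -> R[i]) -> R[i].

Definition linear_subspace S : Prop :=
  S (fun=> 0) /\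
  forall (a : R[i]) f g, S f -> S g -> S ((a \*o f) \+ g).

Definition ip_norm ip f : R := Num.sqrt (complex.Re (ip f f)).

(* [ip] is only constrained on H; it is linear in its first argument. *)
Record hilbert_function_space H ip : Prop := {
  hfs_subspace : linear_subspace H;
  hfs_linear : forall (a : R[i]) f g h, H f -> H g -> H h ->
    ip ((a \*o f) \+ g) h = a * ip f h + ip g h;
  hfs_conj : forall f g, H f -> H g -> ip g f = ((ip f g)^*)%C;
  hfs_ge0 : forall f, H f -> 0 <= ip f f;
  hfs_definite : forall f, H f -> ip f f = 0 -> f = (fun=> 0);
  hfs_complete : forall u : nat -> X -> R[i],
    (forall n, H (u n)) ->
    (forall e : R, 0 < e -> exists N, forall m n, (N <= m)%N -> (N <= n)%N ->
       ip_norm ip (u m \- u n) < e) ->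
    exists2 g, H g & ip_norm ip (u n \- g) @[n --> \oo] --> (0 : R)
}.

(* [K x] is the kernel function at the point x. *)
Record rkhs (K : X -> X -> R[i]) H ip : Prop := {
  rkhs_hilbert : hilbert_function_space H ip;
  rkhs_kernel : forall x, H (K x);
  rkhs_reproducing : forall f x, H f -> f x = ip f (K x)
}.

Definition norm_closed_in H ip S : Prop :=
  forall (u : nat -> X -> R[i]) g, (forall n, S (u n)) -> H g ->
    ip_norm ip (u n \- g) @[n --> \oo] --> (0 : R) -> S g.

End HilbertFunctionSpace.

Definition da_kernel (R : realType) (lambda z : l2_ball R) : R[i] :=
  (1 - l2_inner (sval z) (sval lambda))^-1.

(* A reproducing kernel Hilbert space is determined by its kernel, so at most
   one H, with inner product determined on it, satisfies this predicate. *)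
Definition drury_arveson (R : realType) (H : set (l2_ball R -> R[i]))
    (ip : (l2_ball R -> R[i]) -> (l2_ball R -> R[i]) -> R[i]) : Prop :=
  rkhs (@da_kernel R) H ip /\ forall g, H g -> holomorphic g.

Definition submodule (R : realType) (H : set (l2_ball R -> R[i]))
    (ip : (l2_ball R -> R[i]) -> (l2_ball R -> R[i]) -> R[i])
    (S : set (l2_ball R -> R[i])) : Prop :=
  [/\ S `<=` H, linear_subspace S, norm_closed_in H ip S
    & forall (i : nat) g, S g -> S (fun z => sval z i * g z)].

Definition generated_submodule (R : realType) (H : set (l2_ball R -> R[i]))
    (ip : (l2_ball R -> R[i]) -> (l2_ball R -> R[i]) -> R[i])
    (f : l2_ball R -> R[i]) : set (l2_ball R -> R[i]) :=
  smallest (submodule H ip) [set f].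

Definition poly_fun (R : realType) (m : nat) (p : mpoly.mpoly m R[i]) :
    l2_ball R -> R[i] :=
  fun z => mpoly.meval (fun i : 'I_m => sval z i) p.

(* With the shift of indices, the coefficient 1/(i+1)! of z_i becomes the
   coefficient 1/(k+2)! of [z k]. *)
Definition fact_form (R : realType) : l2_ball R -> R[i] :=
  fun z => csum (fun k => ((k.+2)`!%:R)^-1 * sval z k).

(* Main.v *)
(* Every element of the submodule generated by f vanishes on the zero set Z(f):
   the functions of H^2 vanishing on Z(f) form a submodule containing f.  Since
   f involves all variables with nonzero coefficients, Z(f) is a hyperplane that
   projects onto a neighbourhood of 0 in the first m+1 coordinates (solve f = 0
   for the next coordinate), so a polynomial in these coordinates that vanishes
   on Z(f) is zero.

   As H^2 is only known through its kernel, that f belongs to H^2 and that the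
   coordinate functions are multipliers of H^2 is derived from the criterion
     g in H  <=  |sum_j c_j conj(g(x_j))| <= C |sum_j c_j K_(x_j)|,
   together with the identity K = 1 + <z, lambda> K. *)
Require Import Defs.
From mathcomp Require Import all_boot all_order all_algebra.
From mathcomp Require Import all_classical all_reals all_analysis.
From mathcomp Require Import complex.
From mathcomp Require mpoly.
From mathcomp Require Import ring lra.
Import (canonicals) mpoly.
Import (coercions) mpoly.

Set Implicit Arguments.
Unset Strict Implicit.
Unset Printing Implicit Defensive.

Import Order.TTheory GRing.Theory Num.Theory.
Import numFieldNormedType.Exports.

Local Open Scope classical_set_scope.
Local Open Scope ring_scope.
Local Open Scope complex_scope.

Local Notation normc := Normc.normc.
Local Notation Re := complex.Re.
Local Notation Im := complex.Im.

(** * Modulus, real part and imaginary part of complex numbers *)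

Section ComplexModulus.
Variable R : rcfType.
Implicit Types z w : R[i].

Lemma normc_ge0 z : 0 <= normc z.
Proof. by case: z => a b /=; exact: sqrtr_ge0. Qed.

Lemma normc_conjc z : normc z^*%C = normc z.
Proof. by case: z => a b /=; rewrite sqrrN. Qed.

Lemma sqr_normc_Re z : normc z ^+ 2 = Re (z * z^*%C).
Proof.
case: z => a b /=; rewrite sqr_sqrtr ?addr_ge0 ?sqr_ge0//; ring.
Qed.

Lemma Re_le_normc z : `|Re z| <= normc z.
Proof. by case: z => a b /=; rewrite -sqrtr_sqr ler_wsqrtr// lerDl sqr_ge0. Qed.

Lemma Im_le_normc z : `|Im z| <= normc z.
Proof. by case: z => a b /=; rewrite -sqrtr_sqr ler_wsqrtr// lerDr sqr_ge0. Qed.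

Lemma normc_real (a : R) : normc a%:C = `|a|.
Proof. by rewrite /= expr0n addr0 sqrtr_sqr. Qed.

Lemma ler_normc_sum I (r : seq I) (P : pred I) (F : I -> R[i]) :
  normc (\sum_(k <- r | P k) F k) <= \sum_(k <- r | P k) normc (F k).
Proof.
apply: (big_ind2 (fun z x => normc z <= x)) => [|z x w y hz hw|//].
  by rewrite Normc.normc0.
by rewrite (le_trans (le_normcD _ _))// lerD.
Qed.

Lemma ler_normcB z w : normc (z - w) <= normc z + normc w.
Proof. by rewrite -(normcN w); exact: le_normcD. Qed.

Lemma Re_realM (a : R) z : Re (a%:C * z) = a * Re z.
Proof. by case: z => b c /=; rewrite mul0r subr0. Qed.

Lemma Re_sum I (r : seq I) (P : pred I) (F : I -> R[i]) :
  Re (\sum_(k <- r | P k) F k) = \sum_(k <- r | P k) Re (F k).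
Proof.
by apply: (big_ind2 (fun z x => Re z = x)) => // -[? ?] x [? ?] y /= -> ->.
Qed.

Lemma Im_sum I (r : seq I) (P : pred I) (F : I -> R[i]) :
  Im (\sum_(k <- r | P k) F k) = \sum_(k <- r | P k) Im (F k).
Proof.
by apply: (big_ind2 (fun z x => Im z = x)) => // -[? ?] x [? ?] y /= -> ->.
Qed.

End ComplexModulus.

(* A nonnegative quadratic form [r^2 w F - 2 r w + G] in r has nonpositive
   discriminant; w is divided out so that F = 0 is allowed. *)
Lemma quadratic_bound (R : realFieldType) (w F G : R) :
  0 <= w -> 0 <= F -> 0 <= G ->
  (forall r : R, 0 <= r ^+ 2 * (w * F) - 2 * r * w + G) -> w <= F * G.
Proof.
move=> w0 F0 G0 H; move: F0; rewrite le_eqVlt => /predU1P[F0|F0].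
  move: w0; rewrite le_eqVlt => /predU1P[<-|w0]; first by rewrite mulr_ge0// -F0.
  (* For F = 0 the form is affine in r, and this value of r makes it equal to -1. *)
  have := H ((G + 1) / (2 * w)); rewrite -F0 !mulr0 add0r.
  have -> : - (2 * ((G + 1) / (2 * w)) * w) + G = -1.
    by field; rewrite gt_eqF//.
  by rewrite ler0N1.
(* 1/F minimises the form in r. *)
have := H F^-1.
have -> : F^-1 ^+ 2 * (w * F) - 2 * F^-1 * w + G = (F * G - w) / F.
  by field; rewrite gt_eqF.
by rewrite pmulr_lge0 ?invr_gt0// subr_ge0.
Qed.

(** * The Cauchy-Schwarz inequality in a Hilbert function space *)

Section HilbertFunctionSpaceTheory.
Variables (R : realType) (X : Type).
Variables (H : set (X -> R[i])) (ip : (X -> R[i]) -> (X -> R[i]) -> R[i]).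
Hypothesis hH : hilbert_function_space H ip.
Implicit Types (f g h : X -> R[i]) (a : R[i]).

Let H0 : H (fun=> 0). Proof. by case: (hfs_subspace hH). Qed.

Let HL a f g : H f -> H g -> H ((a \*o f) \+ g).
Proof. by case: (hfs_subspace hH) => _; exact. Qed.

Lemma hfs_sub f g : H f -> H g -> H (f \- g).
Proof.
move=> hf hg; have -> : f \- g = (((-1) \*o g) \+ f).
  by apply/funext => x /=; rewrite mulN1r addrC.
exact: HL.
Qed.

Lemma ip0l h : H h -> ip (fun=> 0) h = 0.
Proof.
move=> hh; have := hfs_linear hH 1 H0 H0 hh.
have -> : (1 \*o (fun=> 0)) \+ (fun=> 0) = (fun=> 0) :> (X -> R[i]).
  by apply/funext => x /=; rewrite mulr0 addr0.
by rewrite mul1r => /esym/eqP; rewrite -subr_eq0 addrK => /eqP.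
Qed.

Lemma ipBl f g h : H f -> H g -> H h -> ip (f \- g) h = ip f h - ip g h.
Proof.
move=> hf hg hh; have -> : f \- g = (((-1) \*o g) \+ f).
  by apply/funext => x /=; rewrite mulN1r addrC.
by rewrite (hfs_linear hH)// mulN1r addrC.
Qed.

Lemma ipBr f g h : H f -> H g -> H h -> ip h (f \- g) = ip h f - ip h g.
Proof.
move=> hf hg hh; rewrite (hfs_conj hH (hfs_sub hf hg) hh) ipBl// rmorphB /=.
by rewrite -(hfs_conj hH hf hh) -(hfs_conj hH hg hh).
Qed.

Lemma ip_self_ge0 f : H f -> 0 <= Re (ip f f).
Proof. by move=> /(hfs_ge0 hH); rewrite lecE => /andP[]. Qed.

Lemma sqr_ip_norm f : H f -> ip_norm ip f ^+ 2 = Re (ip f f).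
Proof. by move=> hf; rewrite sqr_sqrtr// ip_self_ge0. Qed.

Lemma ip_norm_ge0 f : 0 <= ip_norm ip f.
Proof. exact: sqrtr_ge0. Qed.

Lemma Re_ip_expand a f g : H f -> H g ->
  Re (ip ((a \*o f) \+ g) ((a \*o f) \+ g)) =
  normc a ^+ 2 * Re (ip f f) + 2 * Re (a * ip f g) + Re (ip g g).
Proof.
move=> hf hg; have hag := HL a hf hg.
rewrite (hfs_linear hH)// (hfs_conj hH hag hf) (hfs_conj hH hag hg).
rewrite !(hfs_linear hH)// (hfs_conj hH hf hg).
have := hfs_conj hH hf hf; have := hfs_conj hH hg hg.
move: (ip f f) (ip g g) (ip f g) => [u1 u2] [v1 v2] [w1 w2] [eqv] [equ].
have {}equ : u2 = 0 by lra.
have {}eqv : v2 = 0 by lra.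
rewrite equ eqv sqr_normc_Re; case: a {hag} => a1 a2 /=; ring.
Qed.

(* Minimising over the phase and modulus of a. *)
Lemma normc_quadratic_bound (F G : R) (z : R[i]) : 0 <= F -> 0 <= G ->
  (forall a, 0 <= normc a ^+ 2 * F + 2 * Re (a * z) + G) ->
  normc z ^+ 2 <= F * G.
Proof.
move=> F0 G0 hq; apply: quadratic_bound => //; first exact: sqr_ge0.
move=> r; have := hq ((- r)%:C * z^*%C).
rewrite Normc.normcM normc_conjc normc_real exprMn normrN real_normK ?num_real//.
rewrite -(mulrA (- r)%:C) Re_realM (mulrC _ z) -sqr_normc_Re.
by congr (_ <= _); ring.
Qed.

Lemma cauchy_schwarz f g : H f -> H g ->
  normc (ip f g) <= ip_norm ip f * ip_norm ip g.
Proof.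
move=> hf hg; rewrite -(@ler_pXn2r _ 2)//;
  rewrite ?nnegrE ?normc_ge0 ?mulr_ge0 ?ip_norm_ge0//.
rewrite exprMn !sqr_ip_norm//.
apply: normc_quadratic_bound => [||a]; try exact: ip_self_ge0.
by rewrite -Re_ip_expand// ip_self_ge0//; exact: HL.
Qed.

End HilbertFunctionSpaceTheory.

(** * Combinations of kernel functions and the membership criterion *)

Section KernelCombinations.
Variables (R : realType) (X : Type) (K : X -> X -> R[i]).
Variables (H : set (X -> R[i])) (ip : (X -> R[i]) -> (X -> R[i]) -> R[i]).
Hypothesis hK : rkhs K H ip.
Implicit Types (f g h : X -> R[i]) (a : R[i]) (s t : seq (R[i] * X)).

Let hH : hilbert_function_space H ip := rkhs_hilbert hK.

(** Combinations are kept as lists of coefficient-point pairs, repetitions allowed, so that linear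
    operations become mapping and concatenation. *)
Definition kernel_comb s : X -> R[i] := fun y => \sum_(p <- s) p.1 * K p.2 y.

Definition scale_comb a s := [seq (a * p.1, p.2) | p <- s].

Lemma kernel_comb_nil : kernel_comb [::] = (fun=> 0).
Proof. by apply/funext => y; rewrite /kernel_comb big_nil. Qed.

Lemma kernel_comb_cons p s :
  kernel_comb (p :: s) = (p.1 \*o K p.2) \+ kernel_comb s.
Proof. by apply/funext => y; rewrite /kernel_comb big_cons. Qed.

Lemma kernel_comb_scale_cat a s t :
  kernel_comb (scale_comb a s ++ t) = (a \*o kernel_comb s) \+ kernel_comb t.
Proof.
apply/funext => y; rewrite /kernel_comb big_cat big_map/= mulr_sumr.
by congr (_ + _); apply: eq_bigr => p _; rewrite mulrA.
Qed.

Lemma mem_kernel_comb s : H (kernel_comb s).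
Proof.
have [h0 hL] := hfs_subspace hH.
elim: s => [|p s IHs]; first by rewrite kernel_comb_nil.
by rewrite kernel_comb_cons; apply: hL => //; exact: (rkhs_kernel hK).
Qed.

Lemma ip_kernel_comb s g : H g ->
  ip (kernel_comb s) g = \sum_(p <- s) p.1 * (g p.2)^*%C.
Proof.
move=> hg; elim: s => [|p s IHs].
  by rewrite kernel_comb_nil (ip0l hH)// big_nil.
have hp := rkhs_kernel hK p.2.
rewrite kernel_comb_cons (hfs_linear hH)//; last exact: mem_kernel_comb.
by rewrite big_cons IHs (rkhs_reproducing hK p.2 hg) -(hfs_conj hH hg hp).
Qed.

Lemma normc_eval_le f x : H f ->
  normc (f x) <= ip_norm ip f * ip_norm ip (K x).
Proof.
move=> hf; rewrite (rkhs_reproducing hK x hf).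
by apply: (cauchy_schwarz hH) => //; exact: rkhs_kernel hK x.
Qed.

Lemma cvg_eval (u : nat -> X -> R[i]) g x (e : R) : (forall n, H (u n)) -> H g ->
  ip_norm ip (u n \- g) @[n --> \oo] --> (0 : R) -> 0 < e ->
  \forall n \near \oo, normc (u n x - g x) <= e.
Proof.
move=> hu hg ug e0; set k := ip_norm ip (K x).
have k0 : 0 <= k by exact: ip_norm_ge0.
have k1 : 0 < k + 1 by rewrite ltr_wpDl.
have /cvgr0Pnorm_lt/(_ _ (divr_gt0 e0 k1)) := ug.
apply: filterS => n; rewrite ger0_norm ?ip_norm_ge0// => /ltW hn.
have hun := hfs_sub hH (hu n) hg.
apply: le_trans (normc_eval_le x hun) _; rewrite -/k.
rewrite (le_trans (ler_wpM2r k0 hn))// mulrAC ler_pdivrMr// ler_pM2l//.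
by rewrite lerDl.
Qed.

Section Membership.
Variables (g : X -> R[i]) (C : R).
Hypothesis bound_g : forall s,
  normc (\sum_(p <- s) p.1 * (g p.2)^*%C) <= C * ip_norm ip (kernel_comb s).

(** For g in H, [l s] is the inner product of [kernel_comb s] with g, and [J s] is |kernel_comb s -
    g|^2 - |g|^2, so minimising [J] approximates g. *)
Let l s := \sum_(p <- s) p.1 * (g p.2)^*%C.
Let N s := Re (ip (kernel_comb s) (kernel_comb s)).
Let J s := N s - 2 * Re (l s).

Let l_scale_cat a s t : l (scale_comb a s ++ t) = a * l s + l t.
Proof.
rewrite /l big_cat big_map/= mulr_sumr.
by congr (_ + _); apply: eq_bigr => p _; rewrite mulrA.
Qed.

Let N_ge0 s : 0 <= N s.
Proof. by apply: (ip_self_ge0 hH); exact: mem_kernel_comb. Qed.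

Let J_lb s : - C ^+ 2 <= J s.
Proof.
have := le_trans (ler_norm _) (le_trans (Re_le_normc (l s)) (bound_g s)).
have := sqr_ip_norm hH (mem_kernel_comb s).
rewrite /J /N => <-; set n := ip_norm _ _ => h.
have := sqr_ge0 (n - C); nra.
Qed.

Let J_scale_cat a t s : J (scale_comb a t ++ s) =
  normc a ^+ 2 * N t
  + 2 * Re (a * (ip (kernel_comb t) (kernel_comb s) - l t)) + J s.
Proof.
rewrite /J /N kernel_comb_scale_cat l_scale_cat.
rewrite (Re_ip_expand hH)//; try exact: mem_kernel_comb.
move: (l t) (l s) (ip _ _) (ip _ _) (ip _ _) => [l1 l2] [? ?] [? ?] [? ?] [? ?].
by case: a => a1 a2 /=; ring.
Qed.

Let E := [set J s | s in setT].

Let E_inf : has_inf E.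
Proof.
split; first by exists (J [::]); exists [::].
by exists (- C ^+ 2) => _ [s _ <-]; exact: J_lb.
Qed.

Let inf_le s : inf E <= J s.
Proof. by apply: ge_inf; [exact: E_inf.2|exists s]. Qed.

(* First-order optimality: an almost minimiser of J almost represents l. *)
Let near_optimal s (e : R) t : 0 <= e -> J s <= inf E + e ->
  normc (ip (kernel_comb t) (kernel_comb s) - l t) ^+ 2 <= N t * e.
Proof.
move=> e0 hs; apply: normc_quadratic_bound => // a.
have := inf_le (scale_comb a t ++ s); rewrite J_scale_cat; lra.
Qed.

(** Riesz representation by the direct method: almost minimisers of [J] form a Cauchy sequence whose
    limit agrees with g at every point. *)
Lemma rkhs_membership : H g.
Proof.
pose d n : R := n.+1%:R^-1.
have d0 n : 0 < d n by rewrite invr_gt0.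
(* The accuracy is squared because [near_optimal] bounds a squared modulus. *)
have /choice[u hu] : forall n, exists s, J s <= inf E + d n ^+ 2.
  move=> n; have [_ [s _ <-] /ltW hs] := inf_adherent (exprn_gt0 2 (d0 n)) E_inf.
  by exists s.
pose v n := kernel_comb (u n).
have hv n : H (v n) by exact: mem_kernel_comb.
have opt n t :
    normc (ip (kernel_comb t) (v n) - l t) <= ip_norm ip (kernel_comb t) * d n.
  rewrite -(@ler_pXn2r _ 2)//;
    rewrite ?nnegrE ?normc_ge0 ?mulr_ge0 ?ip_norm_ge0 ?(ltW (d0 n))//.
  rewrite exprMn (sqr_ip_norm hH); last exact: mem_kernel_comb.
  by apply: near_optimal => //; rewrite sqr_ge0.
have v_close m n : ip_norm ip (v m \- v n) <= d m + d n.
  pose t := scale_comb (-1) (u n) ++ u m.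
  have et : v m \- v n = kernel_comb t.
    by rewrite kernel_comb_scale_cat; apply/funext => y /=; rewrite mulN1r addrC.
  have ht := mem_kernel_comb t.
  (* The difference is itself the combination t, so its squared norm is the difference of the two
     errors that [opt] bounds when tested with t. *)
  have : ip_norm ip (v m \- v n) ^+ 2 <= ip_norm ip (v m \- v n) * (d m + d n).
    rewrite et (sqr_ip_norm hH)// -{2}et (ipBr hH)//.
    have -> : forall z w, z - w = (z - l t) - (w - l t) by move=> z w; ring.
    rewrite mulrDr.
    apply: le_trans (lerD (opt m t) (opt n t)).
    apply: le_trans (ler_norm _) (le_trans (Re_le_normc _) _).
    exact: ler_normcB.
  have := ip_norm_ge0 ip (v m \- v n); rewrite le_eqVlt => /predU1P[<- _|q0].
    by rewrite addr_ge0// ltW.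
  by rewrite expr2 ler_pM2l.
have d_small e : 0 < e -> \forall n \near \oo, d n < e.
  by move=> e0; have := near_infty_natSinv_lt (PosNum e0).
have [e e0|h hh vh] := hfs_complete hH hv.
  have [k _ hk] := d_small _ (divr_gt0 e0 (ltr0Sn R 1)).
  exists k => m n /hk hm /hk hn; rewrite (le_lt_trans (v_close m n))//.
  by rewrite (splitr e) ltrD.
suff -> : g = h by [].
apply/funext => x; apply/eqP; rewrite -subr_eq0; apply/eqP/Normc.eq0_normc.
apply/eqP; rewrite eq_le normc_ge0 andbT; apply/ler_addgt0Pl => e e0.
(* Testing with the kernel function at x alone turns [opt] into a bound on |v_n(x) - g(x)|. *)
pose t := [:: (1 : R[i], x)].
pose q := ip_norm ip (kernel_comb t).
have q1 : 0 < q + 1 by rewrite ltr_wpDl ?ip_norm_ge0.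
have e2 : 0 < e / 2 by rewrite divr_gt0.
have [n [hn hdn]] := filter_ex (filterI (cvg_eval x hv hh vh e2)
  (d_small _ (divr_gt0 e2 q1))).
have := opt n t; rewrite ip_kernel_comb// /l !big_seq1 !mul1r.
rewrite -rmorphB normc_conjc.
rewrite -/q => hgv.
have -> : g x - h x = (v n x - h x) - (v n x - g x) by ring.
rewrite addr0 (splitr e) (le_trans (ler_normcB _ _))// lerD//.
rewrite (le_trans hgv)//.
rewrite (le_trans (ler_wpM2l (ip_norm_ge0 _ _) (ltW hdn)))//.
by rewrite -/q mulrA ler_pdivrMr// mulrC ler_pM2l// lerDl.
Qed.

End Membership.
End KernelCombinations.

(** * Convergence of complex sequences and series *)

Section ComplexSeries.
Variable R : realType.
Implicit Types (u : nat -> R[i]) (l : R[i]).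

Lemma normc_le_Re_Im (z : R[i]) : normc z <= `|Re z| + `|Im z|.
Proof.
case: z => a b /=; rewrite -(@ler_pXn2r _ 2)//; last 2 first.
- by rewrite nnegrE sqrtr_ge0.
- by rewrite nnegrE addr_ge0.
rewrite sqr_sqrtr ?addr_ge0 ?sqr_ge0// sqrrD !real_normK ?num_real//.
by rewrite -addrA lerD2l addrC lerDl mulrn_wge0// mulr_ge0.
Qed.

(** The norm of [R[i]^o] is complex-valued, so a radius is a complex number with imaginary part 0;
    radii are reduced here to real ones. *)
Lemma cvg_normcP u l : (u : nat -> R[i]^o) @ \oo --> (l : R[i]^o) <->
  forall e : R, 0 < e -> \forall n \near \oo, normc (l - u n) < e.
Proof.
split => [/cvgrPdist_lt h e e0|h].
  have ec : 0 < e%:C by rewrite ltcR.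
  by apply: filterS (h _ ec) => n; rewrite -ltcR.
apply/cvgrPdist_lt => e; rewrite ltcE => /andP[/eqP/= ie e0].
apply: filterS (h _ e0) => n hn.
have -> : e = (Re e)%:C by case: e ie {e0 hn} => a b /= ->.
by rewrite -[X in X < _]/(normc (l - u n))%:C ltcR.
Qed.

Lemma cvg_Re_Im u (a b : R) :
  Re (u n) @[n --> \oo] --> a -> Im (u n) @[n --> \oo] --> b ->
  (u : nat -> R[i]^o) @ \oo --> (a +i* b : R[i]^o).
Proof.
move=> hr hi; apply/cvg_normcP => e e0.
have e2 : 0 < e / 2 by rewrite divr_gt0.
move/cvgrPdist_lt/(_ _ e2) : hr => hr; move/cvgrPdist_lt/(_ _ e2) : hi => hi.
apply: filterS2 hr hi => n hr hi.
rewrite (le_lt_trans (normc_le_Re_Im _))// (splitr e).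
by case: (u n) hr hi => c d /= hr hi; rewrite ltrD.
Qed.

Lemma cvg_Re u l : (u : nat -> R[i]^o) @ \oo --> (l : R[i]^o) ->
  Re (u n) @[n --> \oo] --> Re l.
Proof.
move=> /cvg_normcP h; apply/cvgrPdist_lt => e /h; apply: filterS => n.
apply: le_lt_trans; apply: le_trans (Re_le_normc _).
by case: (u n) l {h} => ? ? [? ?] /=.
Qed.

Lemma cvg_conjc u l : (u : nat -> R[i]^o) @ \oo --> (l : R[i]^o) ->
  (fun n => (u n)^*%C : R[i]^o) @ \oo --> (l^*%C : R[i]^o).
Proof.
move=> /cvg_normcP h; apply/cvg_normcP => e /h; apply: filterS => n.
by rewrite -rmorphB normc_conjc.
Qed.

Lemma cvg_big_sum I (r : seq I) (u : I -> nat -> R[i]) (l : I -> R[i]) :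
  (forall i, (u i : nat -> R[i]^o) @ \oo --> (l i : R[i]^o)) ->
  (fun n => \sum_(i <- r) u i n : R[i]^o) @ \oo --> (\sum_(i <- r) l i : R[i]^o).
Proof.
move=> h; elim: r => [|i r IHr].
  by rewrite big_nil; under eq_fun do rewrite big_nil; exact: cvg_cst.
rewrite big_cons; under eq_fun do rewrite big_cons.
exact: cvgD (h i) IHr.
Qed.

Lemma normc_lim_le u l (B : R) : (u : nat -> R[i]^o) @ \oo --> (l : R[i]^o) ->
  (forall n, normc (u n) <= B) -> normc l <= B.
Proof.
move=> /cvg_normcP h hB; apply/ler_addgt0Pl => e /h/filter_ex[n hn].
rewrite -(subrK (u n) l) (le_trans (le_normcD _ _))// lerD//.
exact: ltW.
Qed.

Section AbsolutelyConvergent.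
Variables (u : nat -> R[i]) (B : R).
Hypothesis abs_u : forall n, \sum_(0 <= k < n) normc (u k) <= B.

Let real_cvg (a : nat -> R) : (forall k, `|a k| <= normc (u k)) ->
  cvgn (series a).
Proof.
move=> ha; apply: normed_cvg; apply: nondecreasing_is_cvgn.
  by apply: nondecreasing_series => k _ _ /=; exact: normr_ge0.
exists B => _ [n _ <-]; rewrite (le_trans _ (abs_u n))// /series/=.
by apply: ler_sum => k _.
Qed.

(** [csum] is a limit, meaningful only under convergence; absolute convergence provides it for the
    real and imaginary parts. *)
Lemma csum_cvg :
  series (u : nat -> R[i]^o) @ \oo --> (csum u : R[i]^o).
Proof.
have hr := real_cvg (fun k => Re_le_normc (u k)).
have hi := real_cvg (fun k => Im_le_normc (u k)).
have h : series (u : nat -> R[i]^o) @ \oo -->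
    (limn (series (fun k => Re (u k))) +i* limn (series (fun k => Im (u k)))
      : R[i]^o).
  apply: cvg_Re_Im.
    by under eq_fun do rewrite /series/= Re_sum; exact: hr.
  by under eq_fun do rewrite /series/= Im_sum; exact: hi.
by rewrite /csum (cvg_lim (@norm_hausdorff _ R[i]^o) h).
Qed.

Lemma normc_csum_le : normc (csum u) <= B.
Proof.
apply: normc_lim_le csum_cvg _ => n.
exact: le_trans (ler_normc_sum _ _ _) (abs_u n).
Qed.

End AbsolutelyConvergent.
End ComplexSeries.

(** * The unit ball of l^2 and its kernel *)

Section Ball.
Variable R : realType.
Implicit Types x y z : l2_ball R.

Lemma l2_ball_partial_sums x : exists2 r : R, r < 1 &
  forall n, \sum_(0 <= k < n) normc (sval x k) ^+ 2 <= r.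
Proof.
case: x => x /= hx; have pos k : (0 <= k)%N -> true ->
  (0 <= (normc (x k) ^+ 2)%:E)%E by move=> _ _; rewrite lee_fin sqr_ge0.
have s0 : (0 <= l2_sqnorm x)%E by apply: nneseries_ge0 => k; exact: pos.
have sfin : l2_sqnorm x \is a fin_num.
  by rewrite ge0_fin_numE// (lt_trans hx)// ltry.
exists (fine (l2_sqnorm x)); first by rewrite -lte_fin fineK.
move=> n; rewrite -lee_fin fineK// -sumEFin.
exact: (nneseries_lim_ge n pos).
Qed.

Lemma l2_inner_cvg x y : normc (l2_inner (sval x) (sval y)) < 1 /\
  series ((fun k => sval x k * (sval y k)^*%C) : nat -> R[i]^o) @ \oo -->
    (l2_inner (sval x) (sval y) : R[i]^o).
Proof.
have [r r1 hr] := l2_ball_partial_sums x.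
have [t t1 ht] := l2_ball_partial_sums y.
(* By 2ab <= a^2 + b^2 the bounds r and t average to one that is still below 1. *)
have abs n : \sum_(0 <= k < n) normc (sval x k * (sval y k)^*%C) <= (r + t) / 2.
  rewrite ler_pdivlMr// mulr_suml.
  apply: le_trans (lerD (hr n) (ht n)); rewrite -big_split/=.
  apply: ler_sum => k _; rewrite Normc.normcM normc_conjc.
  have := sqr_ge0 (normc (sval x k) - normc (sval y k)); nra.
split; last exact: csum_cvg abs.
by apply: le_lt_trans (normc_csum_le abs) _; lra.
Qed.

Lemma da_kernel_rec x y :
  da_kernel x y = 1 + l2_inner (sval y) (sval x) * da_kernel x y.
Proof.
rewrite /da_kernel; set w := l2_inner _ _.
(* As 0 has inverse 0, the identity requires a nonzero denominator, which |w| < 1 provides. *)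
have w1 : 1 - w != 0.
  rewrite subr_eq0; apply/eqP => w1.
  by have [] := l2_inner_cvg y x; rewrite -/w -w1 Normc.normc1 ltxx.
by apply: (mulfI w1); rewrite mulrDr mulrCA divff//; ring.
Qed.

End Ball.

(** * Coordinate multipliers of H^2 and membership of f *)

Section DruryArveson.
Variables (R : realType) (H : set (l2_ball R -> R[i])).
Variable ip : (l2_ball R -> R[i]) -> (l2_ball R -> R[i]) -> R[i].
Hypothesis hK : rkhs (@da_kernel R) H ip.
Implicit Types (s : seq (R[i] * l2_ball R)) (x y z : l2_ball R).

Let hH := rkhs_hilbert hK.

(* The adjoint of multiplication by the coordinate z_k, on combinations of
   kernel functions. *)
Definition adj_coord k s := [seq (p.1 * (sval p.2 k)^*%C, p.2) | p <- s].

Let gram s := ip (kernel_comb (@da_kernel R) s) (kernel_comb (@da_kernel R) s).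

Let gramE s : gram s = \sum_(p <- s) \sum_(q <- s)
  p.1 * (q.1 * da_kernel q.2 p.2)^*%C.
Proof.
rewrite /gram (ip_kernel_comb hK)//; last exact: (mem_kernel_comb hK).
by apply: eq_bigr => p _; rewrite rmorph_sum/= mulr_sumr.
Qed.

(* The recursion K = 1 + <z, lambda> K of the kernel turns into
   |sum_j c_j K_j|^2 = |sum_j c_j|^2 + sum_k |sum_j c_j conj(x_(j,k)) K_j|^2. *)
Lemma adj_coord_cvg s :
  (fun n => \sum_(0 <= k < n) Re (gram (adj_coord k s))) @ \oo -->
  Re (gram s) - normc (\sum_(p <- s) p.1) ^+ 2.
Proof.
have -> : Re (gram s) - normc (\sum_(p <- s) p.1) ^+ 2 =
   Re (\sum_(p <- s) \sum_(q <- s) p.1 * (q.1 * da_kernel q.2 p.2)^*%C *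
     (l2_inner (sval p.2) (sval q.2))^*%C).
  rewrite sqr_normc_Re.
  have -> (z w : R[i]) : Re z - Re w = Re (z - w) by case: z; case: w.
  congr Re; rewrite gramE rmorph_sum/= mulr_suml -sumrB.
  apply: eq_bigr => p _; rewrite mulr_sumr -sumrB; apply: eq_bigr => q _.
  rewrite -mulrBr -mulrA -rmorphB -rmorphM; congr (_ * _^*%C).
  by rewrite {1}da_kernel_rec; ring.
under eq_fun do rewrite -Re_sum.
apply: cvg_Re.
(* The sum over k moves inside the finite double sum, leaving partial sums of [l2_inner], so limits
   can be taken termwise. *)
have -> : (fun n => \sum_(0 <= k < n) gram (adj_coord k s)) =
  fun n => \sum_(p <- s) \sum_(q <- s) p.1 * (q.1 * da_kernel q.2 p.2)^*%C *
     (\sum_(0 <= k < n) sval p.2 k * (sval q.2 k)^*%C)^*%C.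
  apply/funext => n; under eq_bigr do rewrite gramE big_map.
  rewrite exchange_big/=; apply: eq_bigr => p _.
  under eq_bigr do rewrite big_map.
  rewrite exchange_big/=; apply: eq_bigr => q _.
  rewrite rmorph_sum mulr_sumr; apply: eq_bigr => k _ /=.
  by rewrite !rmorphM/= conjcK; ring.
apply: cvg_big_sum => p; apply: cvg_big_sum => q.
apply: (@cvgMl_tmp R[i]^o); apply: cvg_conjc.
exact: (l2_inner_cvg p.2 q.2).2.
Qed.

(** One term of a series with nonnegative terms is at most the sum, which [adj_coord_cvg]
    computes. *)
Lemma adj_coord_le k s :
  Re (gram (adj_coord k s)) + normc (\sum_(p <- s) p.1) ^+ 2 <= Re (gram s).
Proof.
rewrite -lerBrDr; apply: (cvgr_to_ge (@adj_coord_cvg s)).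
exists k.+1 => // n /= kn.
have g0 j : 0 <= Re (gram (adj_coord j s)).
  by apply: (ip_self_ge0 hH); exact: (mem_kernel_comb hK).
rewrite (big_cat_nat (leq0n _) kn)//= big_nat_recr//= -addrA addrCA lerDl.
by rewrite addr_ge0// sumr_ge0.
Qed.

(** The coefficient sum is the pairing with the constant function 1, so this expresses that 1 has
    norm at most 1 in H^2. *)
Lemma normc_sum_coef_le s :
  normc (\sum_(p <- s) p.1) <= ip_norm ip (kernel_comb (@da_kernel R) s).
Proof.
rewrite -(@ler_pXn2r _ 2)// ?nnegrE ?normc_ge0 ?ip_norm_ge0//.
rewrite (sqr_ip_norm hH); last exact: (mem_kernel_comb hK).
apply: le_trans (adj_coord_le 0 s); rewrite lerDr.
by apply: (ip_self_ge0 hH); exact: (mem_kernel_comb hK).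
Qed.

Lemma adj_coord_contraction k s :
  ip_norm ip (kernel_comb (@da_kernel R) (adj_coord k s)) <=
  ip_norm ip (kernel_comb (@da_kernel R) s).
Proof.
rewrite ler_wsqrtr//; apply: le_trans (adj_coord_le k s).
by rewrite lerDl sqr_ge0.
Qed.

Lemma mem_coordM k g : H g -> H (fun z => sval z k * g z).
Proof.
move=> hg; apply: (rkhs_membership (C := ip_norm ip g) hK) => s.
have -> : \sum_(p <- s) p.1 * (sval p.2 k * g p.2)^*%C =
    ip (kernel_comb (@da_kernel R) (adj_coord k s)) g.
  rewrite (ip_kernel_comb hK)// big_map; apply: eq_bigr => p _ /=.
  by rewrite rmorphM mulrA.
rewrite mulrC; apply: le_trans (cauchy_schwarz hH _ hg) _.
  exact: (mem_kernel_comb hK).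
by rewrite ler_wpM2r ?ip_norm_ge0// adj_coord_contraction.
Qed.

Lemma sum_inv_fact_le n : \sum_(0 <= k < n) ((k.+2)`!%:R : R)^-1 <= 1.
Proof.
(* The term 1/(n+1)! makes the bound telescope: the induction step reduces to 2/(n+2) <= 1. *)
suff : \sum_(0 <= k < n) ((k.+2)`!%:R : R)^-1 <= 1 - (n.+1`!%:R)^-1.
  by move=> h; rewrite (le_trans h)// gerBl invr_ge0.
elim: n => [|n IHn]; first by rewrite big_geq// invr1 subrr.
rewrite big_nat_recr//= (le_trans (lerD IHn (lexx _)))//.
have fp : 0 < (n.+1)`!%:R :> R by rewrite ltr0n fact_gt0.
rewrite (factS n.+1) natrM invfM.
set a := (_`!%:R)^-1; have a0 : 0 < a by rewrite invr_gt0.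
have n2 : (n.+2%:R : R)^-1 * 2 <= 1.
  by rewrite mulrC ler_pdivrMr// mul1r ler_nat.
move: (n.+2%:R^-1 : R) n2 => b n2; nra.
Qed.

Lemma normc_inv_nat n : normc ((n%:R)^-1 : R[i]) = (n%:R)^-1.
Proof.
by rewrite Normc.normcV -(rmorph_nat (real_complex R)) normc_real ger0_norm.
Qed.

Lemma normc_coord_le1 z k : normc (sval z k) <= 1.
Proof.
have [r r1 hr] := l2_ball_partial_sums z.
rewrite -(@expr_le1 _ 2)// ?normc_ge0// (le_trans _ (ltW r1))//.
apply: le_trans (hr k.+1); rewrite big_nat_recr//= lerDr sumr_ge0// => j _.
exact: sqr_ge0.
Qed.

Lemma fact_form_cvg z :
  series ((fun k => ((k.+2)`!%:R)^-1 * sval z k) : nat -> R[i]^o) @ \oo -->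
  (fact_form z : R[i]^o).
Proof.
apply: (csum_cvg (B := 1)) => n; apply: le_trans (sum_inv_fact_le n).
apply: ler_sum => k _; rewrite Normc.normcM normc_inv_nat.
by rewrite ler_piMr ?invr_ge0// normc_coord_le1.
Qed.

(** The coefficient sum of [adj_coord k s] is the pairing of the combination with z_k and is at most
    the norm of the combination. As the weights 1/(k+2)! sum to at most 1, the partial sums of f
    satisfy the criterion with constant 1, which passes to the limit. *)
Lemma mem_fact_form : H (@fact_form R).
Proof.
apply: (rkhs_membership (C := 1) hK) => s; rewrite mul1r.
have h : (fun n => \sum_(p <- s) p.1 *
      (series (fun k => ((k.+2)`!%:R)^-1 * sval p.2 k) n)^*%C : R[i]^o) @ \oo -->
    (\sum_(p <- s) p.1 * (fact_form p.2)^*%C : R[i]^o).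
  apply: cvg_big_sum => p; apply: (@cvgMl_tmp R[i]^o); apply: cvg_conjc.
  exact: fact_form_cvg.
apply: (normc_lim_le h) => n.
have -> : \sum_(p <- s) p.1 *
      (series (fun k => ((k.+2)`!%:R)^-1 * sval p.2 k) n)^*%C =
    \sum_(0 <= k < n) ((k.+2)`!%:R)^-1 * \sum_(p <- adj_coord k s) p.1.
  under [RHS]eq_bigr do rewrite big_map mulr_sumr.
  rewrite exchange_big; apply: eq_bigr => p _ /=.
  rewrite rmorph_sum mulr_sumr; apply: eq_bigr => k _ /=.
  by rewrite rmorphM/= conjc_inv conjc_nat; ring.
apply: le_trans (ler_normc_sum _ _ _) _.
set N := ip_norm _ _; have N0 : 0 <= N by exact: ip_norm_ge0.
apply: le_trans (ler_piMl N0 (sum_inv_fact_le n)).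
rewrite mulr_suml; apply: ler_sum => k _; rewrite Normc.normcM normc_inv_nat.
rewrite ler_wpM2l ?invr_ge0//.
exact: le_trans (normc_sum_coef_le _) (adj_coord_contraction _ _).
Qed.
End DruryArveson.

(** * Kronecker substitution for polynomials *)

Lemma digits_inj n d (a b : 'I_n -> nat) :
  (forall i, a i < d)%N -> (forall i, b i < d)%N ->
  (\sum_(i < n) a i * d ^ i = \sum_(i < n) b i * d ^ i)%N -> a =1 b.
Proof.
elim: n a b => [|n IHn] a b ha hb; first by move=> _ [].
have d0 : (0 < d)%N by exact: leq_trans (ha ord0).
have split_sum (c : 'I_n.+1 -> nat) : (\sum_(i < n.+1) c i * d ^ i =
    (\sum_(i < n) c (lift ord0 i) * d ^ i) * d + c ord0)%N.
  rewrite big_ord_recl/= expn0 muln1 addnC big_distrl/=; congr addn.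
  by apply: eq_bigr => i _; rewrite expnSr mulnA.
rewrite !split_sum => e i.
(* Reduction modulo d isolates the lowest digit; cancelling d then leaves the remaining ones. *)
have e0 : a ord0 = b ord0.
  by have := congr1 (modn^~ d) e; rewrite !modnMDl !modn_small.
have eS : (fun j => a (lift ord0 j)) =1 (fun j => b (lift ord0 j)).
  apply: IHn => //; apply/eqP; rewrite -(eqn_pmul2r d0); apply/eqP.
  by move: e; rewrite e0 => /addIn.
by case: (unliftP ord0 i) => [j ->|->]; [exact: eS|].
Qed.

(* Kronecker's substitution x_i = t^(d^i) turns distinct monomials of degree
   less than d into distinct powers of t. *)
Lemma mpoly_eq0_on_powers (F : idomainType) n (p : mpoly.mpoly n F)
    (t : nat -> F) : injective t ->
  (forall d j, mpoly.meval (fun i : 'I_n => t j ^+ (d.+1 ^ i)) p = 0) ->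
  p = 0.
Proof.
move=> t_inj hp; pose d' := (\max_(m <- mpoly.msupp p) mpoly.mdeg m)%N.
(* Every exponent is at most the total degree, hence a digit in base d. *)
pose d := d'.+1.
pose e (m : mpoly.multinom n) := (\sum_(i < n) m i * d ^ i)%N.
(* q is p with the power d^i of the indeterminate substituted for the i-th variable. *)
pose q : {poly F} :=
  \sum_(m <- mpoly.msupp p) mpoly.mcoeff m p *: 'X^(e m).
have q_eval j : q.[t j] = 0.
  rewrite -[RHS](hp d' j) mpoly.mevalE horner_sum; apply: eq_bigr => m _.
  rewrite hornerZ hornerXn; congr (_ * _).
  rewrite expr_sum; apply: eq_bigr => i _.
  by rewrite -exprM mulnC.
have q0 : q = 0.
  (* q vanishes at [size q] distinct points, more than its degree allows. *)
  apply: (@roots_geq_poly_eq0 _ _ [seq t j | j <- iota 0 (size q)]).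
  - by apply/allP => _ /mapP[j _ ->]; rewrite /root q_eval.
  - by rewrite map_inj_uniq ?iota_uniq.
  - by rewrite size_map size_iota.
have m_lt m i : m \in mpoly.msupp p -> (m i < d)%N.
  move=> mp; rewrite /d ltnS.
  have := @leq_bigmax_seq _ _ xpredT (fun m => mpoly.mdeg m) m mp isT.
  apply: leq_trans.
  by rewrite mpoly.mdegE (bigD1 i)//= leq_addr.
apply: mpoly.msuppnil0; case E : (mpoly.msupp p) => [//|m0 r].
have m0p : m0 \in mpoly.msupp p by rewrite E mem_head.
(* As [e] separates the monomials of p, this coefficient of q is the coefficient of m0 in p. *)
have := congr1 (fun q : {poly F} => q`_(e m0)) q0.
rewrite coef0 coef_sum (bigD1_seq m0)//=.
rewrite coefZ coefXn eqxx mulr1 big_seq_cond big1 ?addr0.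
  by move=> m0_0; move: m0p; rewrite mpoly.mcoeff_msupp m0_0 eqxx.
move=> m /andP[mp mm0]; rewrite coefZ coefXn; case: eqP => [em|]; last first.
  by rewrite mulr0.
have /mpoly.mnmP em' : m0 =1 m by apply: digits_inj em => i; exact: m_lt.
by rewrite em' eqxx in mm0.
Qed.

(** * Finitely supported points of the ball *)

Section FiniteSupport.
Variable R : realType.
Implicit Types (z u : nat -> R[i]).

Lemma csum_finite u n : (forall k, (n <= k)%N -> u k = 0) ->
  csum u = \sum_(0 <= k < n) u k.
Proof.
move=> u0; rewrite /csum; apply: (cvg_lim (@norm_hausdorff _ R[i]^o)).
apply: cvg_near_cst; exists n => // k /= nk.
rewrite /series/= (big_cat_nat (leq0n _) nk)/= [X in _ + X]big_nat_cond.
by rewrite [X in _ + X]big1 ?addr0// => j /andP[/andP[nj _] _]; exact: u0.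
Qed.

Lemma l2_sqnorm_finite_lt1 z n (c : R) : (forall k, (n <= k)%N -> z k = 0) ->
  (forall k, normc (z k) <= c) -> n%:R * c ^+ 2 < 1 -> (l2_sqnorm z < 1)%E.
Proof.
move=> z0 zc c1; apply: (@le_lt_trans _ _ (n%:R * c ^+ 2)%:E); last first.
  by rewrite lte_fin.
apply: lime_le.
  by apply: is_cvg_nneseries => k _ _; rewrite lee_fin sqr_ge0.
apply: nearW => N; rewrite sumEFin lee_fin.
have sq0 k : 0 <= normc (z k) ^+ 2 by exact: sqr_ge0.
(* Passing through n + N terms avoids comparing N with n. *)
apply: (@le_trans _ _ (\sum_(0 <= k < n + N) normc (z k) ^+ 2)).
  by rewrite addnC (big_cat_nat (leq0n _) (leq_addr n N))/= lerDl sumr_ge0.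
rewrite (big_cat_nat (leq0n _) (leq_addr N n))/= [X in _ + X]big_nat_cond.
rewrite [X in _ + X]big1 ?addr0; last first.
  by move=> k /andP[/andP[nk _] _]; rewrite z0// Normc.normc0 expr0n.
apply: (@le_trans _ _ (\sum_(0 <= k < n) c ^+ 2)).
  apply: ler_sum => k _; rewrite lerXn2r// nnegrE ?normc_ge0//.
  by rewrite (le_trans _ (zc k))// normc_ge0.
by rewrite sumr_const_nat subn0 mulr_natl.
Qed.

End FiniteSupport.

(** * Zero sets and the generated submodule *)

Section ZeroSet.
Variables (R : realType) (H : set (l2_ball R -> R[i])).
Variable ip : (l2_ball R -> R[i]) -> (l2_ball R -> R[i]) -> R[i].
Hypothesis hK : rkhs (@da_kernel R) H ip.

Definition vanishing_on (Z : set (l2_ball R)) : set (l2_ball R -> R[i]) :=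
  [set g | H g /\ forall z, Z z -> g z = 0].

(** Norm convergence forces pointwise convergence by [cvg_eval], whence closedness; invariance is
    [mem_coordM]. *)
Lemma submodule_vanishing_on Z : submodule H ip (vanishing_on Z).
Proof.
have [H0 HL] := hfs_subspace (rkhs_hilbert hK).
split.
- by move=> g [].
- split; first by split.
  move=> a f g [hf f0] [hg g0]; split; first exact: HL.
  by move=> z Zz /=; rewrite f0// g0// mulr0 addr0.
- move=> u g hu hg ug; split=> // z Zz; apply: Normc.eq0_normc.
  apply/eqP; rewrite eq_le normc_ge0 andbT; apply/ler_addgt0Pl => e e0.
  have huH n : H (u n) by have [] := hu n.
  have [n] := filter_ex (cvg_eval hK z huH hg ug e0).
  by rewrite (hu n).2// sub0r addr0 (normcN (g z)).
- move=> k g [hg g0]; split; first exact: mem_coordM hK _ _ hg.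
  by move=> z Zz; rewrite g0// mulr0.
Qed.

Lemma generated_submodule_zero f g z : H f ->
  generated_submodule H ip f g -> f z = 0 -> g z = 0.
Proof.
move=> hf hg fz.
have [] := hg (vanishing_on [set z | f z = 0]); last by move=> _; apply.
split; first exact: submodule_vanishing_on.
by move=> _ ->; split.
Qed.

End ZeroSet.

(* The hyperplane is a graph over the first m+1 coordinates: solve for z_(m+1). *)
Lemma fact_form_zero (R : realType) (m : nat) (t : R) (a : nat -> R[i]) :
  0 <= t -> (((m.+3)`! * m.+1 * m.+2)%N%:R * t <= 1) ->
  (forall k, normc (a k) <= t) ->
  exists2 z : l2_ball R, fact_form z = 0 & forall k, (k <= m)%N -> sval z k = a k.
Proof.
move=> t0 t1 ha.
pose S := \sum_(0 <= k < m.+1) ((k.+2)`!%:R)^-1 * a k.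
(* The coordinate m+1 has coefficient 1/(m+3)! in f, and S is the contribution of the coordinates
   before it. *)
pose w k := if (k <= m)%N then a k else
  if k == m.+1 then - ((m.+3)`!%:R * S) else 0.
have w0 k : (m.+2 <= k)%N -> w k = 0.
  by move=> mk; rewrite /w leqNgt (ltn_trans _ mk)//= gtn_eqF.
(* c bounds both the prescribed coordinates, at most t, and the solved one, at most (m+3)! (m+1)
   t. *)
pose c : R := ((m.+3)`! * m.+1)%N%:R * t.
have S_le : normc S <= m.+1%:R * t.
  apply: le_trans (ler_normc_sum _ _ _) _.
  apply: (@le_trans _ _ (\sum_(0 <= k < m.+1) t)); last first.
    by rewrite sumr_const_nat subn0 mulr_natl.
  apply: ler_sum => k _; rewrite Normc.normcM normc_inv_nat.
  rewrite -[leRHS]mul1r ler_pM ?invr_ge0 ?normc_ge0//.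
  by rewrite invf_le1 ?ltr0n ?fact_gt0// ler1n fact_gt0.
have w_le k : normc (w k) <= c.
  rewrite /w; case: ifP => _.
    rewrite (le_trans (ha k))// ler_peMl// ler1n.
    by rewrite muln_gt0 fact_gt0.
  case: ifP => _; last by rewrite Normc.normc0 mulr_ge0.
  rewrite (normcN (_ : R[i])) Normc.normcM -(rmorph_nat (real_complex R)).
  by rewrite normc_real ger0_norm// /c natrM -mulrA ler_wpM2l.
(* At most m+2 coordinates are nonzero; c (m+2) <= 1 forces c < 1, hence (m+2) c^2 < 1. *)
have w_ball : (l2_sqnorm w < 1)%E.
  apply: (l2_sqnorm_finite_lt1 w0 w_le).
  have c0 : 0 <= c by rewrite mulr_ge0.
  have c1 : c * m.+2%:R <= 1.
    by move: t1; rewrite natrM mulrAC.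
  have m2 : (1 : R) < m.+2%:R by rewrite ltr1n.
  move: (m.+2%:R : R) m2 c1 => x x1 cx.
  have c_lt1 : c < 1 by nra.
  by rewrite expr2 mulrA (mulrC x) (le_lt_trans _ c_lt1)// ler_piMl.
exists (exist _ w w_ball); last by move=> k km; rewrite /= /w km.
rewrite /fact_form/= (@csum_finite _ _ m.+2); last first.
  by move=> k mk; rewrite w0// mulr0.
rewrite big_nat_recr//= {2}/w ltnn eqxx.
have -> : \sum_(0 <= k < m.+1) ((k.+2)`!%:R)^-1 * w k = S.
  by rewrite /S !big_mkord; apply: eq_bigr => k _; rewrite /w -ltnS ltn_ord.
by rewrite mulrN mulKf ?subrr// pnatr_eq0 -lt0n fact_gt0.
Qed.

Theorem proposition5p2 (R : realType) (H2 : set (l2_ball R -> R[i]))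
    (ip : (l2_ball R -> R[i]) -> (l2_ball R -> R[i]) -> R[i])
    (hH2 : drury_arveson H2 ip) :
  H2 (@fact_form R) /\
  forall (m : nat) (p : mpoly.mpoly m.+1 R[i]),
    generated_submodule H2 ip (@fact_form R) (poly_fun p) -> p = 0.
Proof.
have [hK _] := hH2.
have hf := mem_fact_form hK; split=> // m p hp.
(* D is the constant in the smallness condition of [fact_form_zero]; the points 1/(D+j) are distinct
   and all satisfy it. *)
pose D := ((m.+3)`! * m.+1 * m.+2)%N.
have D0 : (0 < D)%N by rewrite !muln_gt0 fact_gt0.
pose t j : R := (D + j)%:R^-1.
have Dj j : 0 < (D + j)%:R :> R by rewrite ltr0n addn_gt0 D0.
have t0 j : 0 <= t j by rewrite invr_ge0.
have t1 j : t j <= 1 by rewrite invf_le1// ler1n addn_gt0 D0.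
apply: (@mpoly_eq0_on_powers _ _ _ (fun j => (t j)%:C)).
  move=> i j /complexI /invr_inj /eqP; rewrite eqr_nat eqn_add2l.
  by move=> /eqP.
move=> d j.
have [||k|z fz za] :=
  @fact_form_zero R m (t j) (fun k => (t j)%:C ^+ (d.+1 ^ k)) => //.
- by rewrite ler_pdivrMr// mul1r ler_nat leq_addr.
(* The exponent is positive and t_j <= 1, so every power is at most t_j. *)
- rewrite -rmorphXn normc_real ger0_norm ?exprn_ge0//.
  by rewrite -[leRHS]expr1 ler_wiXn2l// expn_gt0.
rewrite -[RHS](generated_submodule_zero hK hf hp fz).
(* The polynomial only sees the coordinates up to m, where z agrees with the powers of t_j. *)
apply: mpoly.meval_eq => i; rewrite za//.
by rewrite -ltnS ltn_ord.
Qed.
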